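(* Let an $s$-stage explicit Runge-Kutta method with coefficients $a_{ij}$, $b_i$, $c_i$ be a 2N-storage method with 2N-storage coefficients $A_i$, $B_i$ such that $A_i\ne0$ for $i=2,\dots,s$, and write $a_{s+1,i}=b_i$. Then for every $i=2,\dots,s$ $$A_i=\frac{a_{i+1,i-1}-a_{i,i-1}}{B_i}.$$ Consequently, Williamson's formula for the special case $b_i=0$, $i\ne1$, namely $$A_i=\frac{a_{i+1,i-1}-c_i}{B_i},$$ is correct when $i=2$, but it is incorrect in general when $i>2$: there exist a four-stage 2N-storage method with $b_3=0$ and a five-stage 2N-storage method with $b_4=0$ (both with all $A_i\neq 0$, $i\ge2$, and both satisfying the third-order conditions $\sum_i b_i=1$, $\sum_i b_ic_i=\tfrac12$, $\sum_i b_ic_i^2=\tfrac13$, $\sum_{i,j}b_ia_{ij}c_j=\tfrac16$) for which Williamson's formula fails at $i=3$ and $i=4$, respectively.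
   Context: An $s$-stage explicit Runge-Kutta method ($a$-form) has real coefficients $a_{ij}$ ($i,j=1,\dots,s$, $a_{ij}=0$ for $i\le j$), $b_i$ and nodes $c_i=\sum_{j=1}^{i-1}a_{ij}$ (so $c_1=0$). With step size $h$ it computes $y_i=y_0+h\sum_{j=1}^{i-1}a_{ij}k_j$, $k_i=f(t+c_ih,y_i)$, $i=1,\dots,s$, and $y_{s+1}=y_0+h\sum_{i=1}^s b_ik_i$. 2N-storage method ($A$-form): the method is a 2N-storage method with coefficients $A_1=0,A_2,\dots,A_s$ and $B_1,\dots,B_s$, all $B_i\ne0$, if its stages coincide (identically, as formal linear combinations of $y_0$ and $k_1,\dots,k_s$, treated as independent symbols) with those produced by $y_1=y_0$, $\Delta y_2=hk_1$, $\Delta y_i=A_{i-1}\Delta y_{i-1}+hk_{i-1}$ for $i=3,\dots,s+1$, and $y_i=y_{i-1}+B_{i-1}\Delta y_i$ for $i=2,\dots,s+1$. *)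

(* Defs.v *)
From mathcomp Require Import all_boot all_order all_algebra.
From mathcomp Require Import reals.

Set Implicit Arguments.
Unset Strict Implicit.
Unset Printing Implicit Defensive.

Import GRing.Theory.
Local Open Scope ring_scope.

(* All families are indexed by nat and 1-based, as is customary for Butcher
   tableaux; only the values at indices 1 .. s (1 .. s+1 for the stages) are
   meaningful, and nothing below depends on the others. *)

Record erk_method (R : realType) (s : nat) := ERKMethod {
  rk_a : nat -> nat -> R;
  rk_b : nat -> R;
  rk_explicit : forall i j : nat,
    (1 <= i <= s)%N -> (1 <= j <= s)%N -> (i <= j)%N -> rk_a i j = 0
}.

Definition rk_c (R : realType) (s : nat) (M : erk_method R s) (i : nat) : R :=
  \sum_(1 <= j < i) rk_a M i j.

(* Extended tableau: the row of index s+1 is b. *)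
Definition rk_ax (R : realType) (s : nat) (M : erk_method R s) (i j : nat) : R :=
  if i == s.+1 then rk_b M j else rk_a M i j.

(* y_i for 1 <= i <= s+1; the case i = s+1 is the update with weights b. *)
Definition rk_stage (R : realType) (V : lmodType R) (s : nat)
    (M : erk_method R s) (h : R) (y0 : V) (k : nat -> V) (i : nat) : V :=
  y0 + h *: \sum_(1 <= j < i) rk_ax M i j *: k j.

(* Delta y_i, starting at i = 2; the values at 0 and 1 are never used. *)
Fixpoint lowst_dy (R : realType) (V : lmodType R) (A : nat -> R) (h : R)
    (k : nat -> V) (i : nat) : V :=
  if i is i'.+1 then
    match i' with
    | 0 => 0
    | 1 => h *: k 1%N
    | _ => A i' *: lowst_dy A h k i' + h *: k i'
    end
  else 0.

(* y_i, starting at i = 1 with y_1 = y_0. *)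
Fixpoint lowst_y (R : realType) (V : lmodType R) (A B : nat -> R) (h : R)
    (y0 : V) (k : nat -> V) (i : nat) : V :=
  if i is i'.+1 then
    match i' with
    | 0 => y0
    | _ => lowst_y A B h y0 k i' + B i' *: lowst_dy A h k i
    end
  else y0.

(* Formal linear combinations of the s+1 independent symbols y_0, k_1, .., k_s
   are the vectors of R^(s+1): index 0 stands for y_0, index j for k_j. *)
Definition sym (R : realType) (s j : nat) : 'rV[R]_s.+1 := delta_mx 0 (inord j).

Definition is_2N_storage (R : realType) (s : nat) (M : erk_method R s)
    (A B : nat -> R) : Prop :=
  [/\ A 1%N = 0,
      forall i : nat, (1 <= i <= s)%N -> B i != 0 &
      forall (h : R) (i : nat), (1 <= i <= s.+1)%N ->
        rk_stage M h (sym R s 0) (sym R s) i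
        = lowst_y A B h (sym R s 0) (sym R s) i].

Definition williamson_formula (R : realType) (s : nat) (M : erk_method R s)
    (A B : nat -> R) (i : nat) : Prop :=
  A i = (rk_ax M i.+1 i.-1 - rk_c M i) / B i.

Definition third_order (R : realType) (s : nat) (M : erk_method R s) : Prop :=
  [/\ \sum_(1 <= i < s.+1) rk_b M i = 1,
      \sum_(1 <= i < s.+1) rk_b M i * rk_c M i = 1 / 2,
      \sum_(1 <= i < s.+1) rk_b M i * rk_c M i ^+ 2 = 1 / 3 &
      \sum_(1 <= i < s.+1) \sum_(1 <= j < s.+1)
        rk_b M i * rk_a M i j * rk_c M j = 1 / 6].

(* Main.v *)
(** Eliminating the increments [Delta y_i] gives the closed form
    [a_(i,j) = \sum_(j <= m < i) B_m A_(j+1) ... A_m]. By independence of the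
    symbols this is the tableau of every 2N-storage method, and consecutive rows
    differ in column [i-1] by [B_i A_i]. Hence Williamson's formula at [i] is
    correct only if [c_i = a_(i,i-1)], that is, [a_(i,1) + ... + a_(i,i-2) = 0].
    Conversely every pair [A, B] yields a 2N-storage method, so the
    counterexamples reduce to finding rational points of the third-order
    conditions with [b_(s-1) = 0]. *)
Require Import Defs.
From mathcomp Require Import all_boot all_order all_algebra.
From mathcomp Require Import reals.
From mathcomp Require Import lra.

Import GRing.Theory.
Local Open Scope ring_scope.

(* For [i <= j] the empty product gives [1] instead of [0]; only [j < i] is used. *)
Definition dy_coef (R : realType) (A : nat -> R) (i j : nat) : R :=
  \prod_(j.+1 <= m < i) A m.

Definition y_coef (R : realType) (A B : nat -> R) (i j : nat) : R :=
  \sum_(j <= m < i) B m * dy_coef R A m.+1 j.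

Lemma lowst_dyE (R : realType) (V : lmodType R) (A : nat -> R) (h : R)
    (k : nat -> V) (i : nat) :
  lowst_dy A h k i = h *: \sum_(1 <= j < i) dy_coef R A i j *: k j.
Proof.
(* The default value [0] at the indices 0 and 1 agrees with the empty sum, so the formula holds for
   every [i]; the recursion proper starts at index 2. *)
case: i => [|i]; first by rewrite big_geq // scaler0.
elim: i => [|[|i] IHi]; first by rewrite big_geq // scaler0.
  by rewrite big_nat1 /dy_coef big_geq // scale1r.
rewrite [LHS]/= -/(lowst_dy A h k i.+2) IHi [in RHS]big_nat_recr //= scalerDr.
have -> : dy_coef R A i.+3 i.+2 = 1 by rewrite /dy_coef big_geq.
rewrite scale1r; congr (_ + _).
rewrite scalerA mulrC -scalerA; congr (_ *: _).
rewrite scaler_sumr; apply: eq_big_nat => j /andP[_ lt_j].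
by rewrite scalerA /dy_coef [in RHS]big_nat_recr //= mulrC.
Qed.

Lemma y_coefS (R : realType) (A B : nat -> R) (i j : nat) : (j <= i)%N ->
  y_coef R A B i.+1 j = y_coef R A B i j + B i * dy_coef R A i.+1 j.
Proof. by move=> le_ji; rewrite /y_coef big_nat_recr. Qed.

Lemma y_coef_eq0 (R : realType) (A B : nat -> R) (i j : nat) : (i <= j)%N ->
  y_coef R A B i j = 0.
Proof. by move=> le_ij; rewrite /y_coef big_geq. Qed.

Lemma lowst_yE (R : realType) (V : lmodType R) (A B : nat -> R) (h : R)
    (y0 : V) (k : nat -> V) (i : nat) :
  lowst_y A B h y0 k i = y0 + h *: \sum_(1 <= j < i) y_coef R A B i j *: k j.
Proof.
case: i => [|i]; first by rewrite big_geq // scaler0 addr0.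
elim: i => [|i IHi]; first by rewrite big_geq // scaler0 addr0.
transitivity (lowst_y A B h y0 k i.+1 + B i.+1 *: lowst_dy A h k i.+2) => //.
rewrite IHi lowst_dyE -addrA; congr (_ + _).
rewrite scalerA mulrC -scalerA -scalerDr; congr (_ *: _).
(* A zero term at [j = i.+1] gives this sum the range of the increment, so that the two can be added
   term by term. *)
have -> : \sum_(1 <= j < i.+1) y_coef R A B i.+1 j *: k j =
          \sum_(1 <= j < i.+2) y_coef R A B i.+1 j *: k j.
  by rewrite [RHS]big_nat_recr //= y_coef_eq0 // scale0r addr0.
rewrite scaler_sumr -big_split; apply: eq_big_nat => j /andP[_ lt_j].
by rewrite /= scalerA -scalerDl -y_coefS.
Qed.

(** Independence of the symbols. The bound on [n] keeps all indices at most [s], where [inord] is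
    injective; beyond that it collapses to 0. *)
Lemma sym_sum_coef (R : realType) (s n j : nat) (F : nat -> R) :
  (n <= s.+1)%N -> (1 <= j < n)%N ->
  (\sum_(1 <= l < n) F l *: sym R s l) 0 (inord j) = F j.
Proof.
move=> le_ns /andP[j_gt0 lt_jn].
rewrite summxE (bigD1_seq j) ?iota_uniq ?mem_index_iota ?j_gt0 //=.
rewrite big1_seq => [|l /andP[neq_lj]].
  by rewrite !mxE !eqxx mulr1 addr0.
rewrite mem_index_iota => /andP[_ lt_ln]; rewrite !mxE eqxx /=.
rewrite -val_eqE /= !inordK ?(leq_trans lt_jn) ?(leq_trans lt_ln) //.
by rewrite eq_sym (negbTE neq_lj) mulr0.
Qed.

Lemma is_2N_storage_coef {R : realType} {s : nat} {M : erk_method R s}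
    {A B : nat -> R} (i j : nat) :
  is_2N_storage M A B -> (1 <= j < i)%N -> (i <= s.+1)%N ->
  rk_ax M i j = y_coef R A B i j.
Proof.
move=> [_ _ M2N] lt_ji le_is.
have i_gt0 : (1 <= i <= s.+1)%N.
  by rewrite le_is andbT; case: (i) lt_ji => //; rewrite andbF.
(* The step size 1 suffices: after cancelling [y0], the coefficients of [k j] can be compared
   directly. *)
have := M2N 1 i i_gt0.
rewrite /rk_stage lowst_yE => /addrI; rewrite !scale1r.
by move/(congr1 (fun v : 'rV_s.+1 => v 0 (inord j))); rewrite !sym_sum_coef.
Qed.

Lemma storage_coef_from_tableau (R : realType) (s : nat) (M : erk_method R s)
    (A B : nat -> R) (i : nat) :
  is_2N_storage M A B -> (2 <= i <= s)%N ->
  A i = (rk_ax M i.+1 i.-1 - rk_ax M i i.-1) / B i.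
Proof.
case: i => [|[|i]] // M2N /andP[_ le_is].
have Bi_neq0 : B i.+2 != 0 by case: M2N => _ + _; apply.
rewrite !(is_2N_storage_coef _ _ M2N) //=; last exact: leqW.
(* Only the summand [m = i.+2] separates the two rows, and its product has the single factor
   [A i.+2]. *)
rewrite y_coefS // addrAC subrr add0r /dy_coef big_nat1.
by rewrite mulrC mulrA mulVf // mul1r.
Qed.

Lemma storage_method_explicit (R : realType) (s : nat) (A B : nat -> R)
    (i j : nat) :
  (1 <= i <= s)%N -> (1 <= j <= s)%N -> (i <= j)%N -> y_coef R A B i j = 0.
Proof. by move=> _ _; apply: y_coef_eq0. Qed.

(** The weights are row [s.+1] of the closed form; the stage coefficients are inferred from the type
    of the explicitness proof. *)
Definition storage_method (R : realType) (s : nat) (A B : nat -> R) :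
    erk_method R s :=
  ERKMethod (y_coef R A B s.+1) (storage_method_explicit R s A B).

Lemma rk_ax_storage_method (R : realType) (s : nat) (A B : nat -> R)
    (i j : nat) :
  rk_ax (storage_method R s A B) i j = y_coef R A B i j.
Proof. by rewrite /rk_ax; case: eqP => [->|]. Qed.

Lemma storage_method_is_2N (R : realType) (s : nat) (A B : nat -> R) :
  A 1%N = 0 -> (forall i : nat, (1 <= i <= s)%N -> B i != 0) ->
  is_2N_storage (storage_method R s A B) A B.
Proof.
move=> A1 B_neq0; split=> // h i _; rewrite lowst_yE /rk_stage.
by under eq_bigr do rewrite rk_ax_storage_method.
Qed.

Lemma williamson_counterexample4 (R : realType) :
  exists (M : erk_method R 4) (A B : nat -> R),
    [/\ is_2N_storage M A B,
        forall i : nat, (2 <= i <= 4)%N -> A i != 0,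
        rk_b M 3 = 0,
        third_order M &
        ~ williamson_formula M A B 3].
Proof.
(* The leading [0] pads the lists to 1-based indexing. Here [b_3 = B_3 + B_4 A_4 = 0], the weights
   are [7/3, -3/2, 0, 1/6] and the nodes [0, -1/6, 5/6, 3/2]. The formula fails because
   [a_31 = 7/3]. *)
pose A := nth (0 : R) [:: 0; 0; - (5 / 3); 1 / 2; - 6].
pose B := nth (0 : R) [:: 0; - (1 / 6); - (3 / 2); 1; 1 / 6].
exists (storage_method R 4 A B), A, B; split.
- apply: storage_method_is_2N => // -[|[|[|[|[|i]]]]] //= _;
    apply/eqP; rewrite /B /= => ?; lra.
- move=> [|[|[|[|[|i]]]]] //= _; apply/eqP; rewrite /A /= => ?; lra.
(* [unlock] lets the sums and products over concrete ranges compute, leaving rational arithmetic. *)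
- rewrite /= /y_coef /dy_coef unlock /= /A /B /=; lra.
- split; rewrite /rk_c /= /y_coef /dy_coef unlock /= /A /B /=; lra.
- rewrite /williamson_formula rk_ax_storage_method /rk_c /= /y_coef /dy_coef.
  rewrite unlock /= /A /B /= => ?; lra.
Qed.

Lemma williamson_counterexample5 (R : realType) :
  exists (M : erk_method R 5) (A B : nat -> R),
    [/\ is_2N_storage M A B,
        forall i : nat, (2 <= i <= 5)%N -> A i != 0,
        rk_b M 4 = 0,
        third_order M &
        ~ williamson_formula M A B 4].
Proof.
(* Now [b_4 = B_4 + B_5 A_5 = 0], with weights [1/6, 2/3, 2/3, 0, -1/2] and nodes
   [0, 1/2, 1, 3/2, 1]. The formula fails because [a_41 + a_42 = 5/6]. *)
pose A := nth (0 : R) [:: 0; 0; - (1 / 2); - (1 / 2); 2 / 3; - (2 / 3)].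
pose B := nth (0 : R) [:: 0; 1 / 2; 1; 2 / 3; - (1 / 3); - (1 / 2)].
exists (storage_method R 5 A B), A, B; split.
- apply: storage_method_is_2N => // -[|[|[|[|[|[|i]]]]]] //= _;
    apply/eqP; rewrite /B /= => ?; lra.
- move=> [|[|[|[|[|[|i]]]]]] //= _; apply/eqP; rewrite /A /= => ?; lra.
- rewrite /= /y_coef /dy_coef unlock /= /A /B /=; lra.
- split; rewrite /rk_c /= /y_coef /dy_coef unlock /= /A /B /=; lra.
- rewrite /williamson_formula rk_ax_storage_method /rk_c /= /y_coef /dy_coef.
  rewrite unlock /= /A /B /= => ?; lra.
Qed.

Theorem mainTheorem6 (R : realType) :
  (forall (s : nat) (M : erk_method R s) (A B : nat -> R),
     is_2N_storage M A B ->
     (forall i : nat, (2 <= i <= s)%N -> A i != 0) ->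
     (forall i : nat, (2 <= i <= s)%N ->
        A i = (rk_ax M i.+1 i.-1 - rk_ax M i i.-1) / B i)
     /\ ((2 <= s)%N -> rk_b M 2 = 0 -> williamson_formula M A B 2))
  /\ (exists (M : erk_method R 4) (A B : nat -> R),
        [/\ is_2N_storage M A B,
            forall i : nat, (2 <= i <= 4)%N -> A i != 0,
            rk_b M 3 = 0,
            third_order M &
            ~ williamson_formula M A B 3])
  /\ (exists (M : erk_method R 5) (A B : nat -> R),
        [/\ is_2N_storage M A B,
            forall i : nat, (2 <= i <= 5)%N -> A i != 0,
            rk_b M 4 = 0,
            third_order M &
            ~ williamson_formula M A B 4]).
Proof.
split; last first.
  split; first exact: williamson_counterexample4.
  exact: williamson_counterexample5.
move=> s M A B M2N _; split=> [i|s_ge2 _].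
  exact: storage_coef_from_tableau.
rewrite /williamson_formula (storage_coef_from_tableau R s M A B) ?s_ge2 //.
(* The node [c_2] is the single term [a_21], and [2 <= s] ensures that row 2 is a stage and not the
   row of weights. *)
by rewrite /rk_c big_nat1 {2}/rk_ax ltn_eqF.
Qed.
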